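(* Let $k$ be a finite field, $r\ge2$, and let $Y$ be an irreducible algebraic set over $F_r$ whose coordinate algebra satisfies $\Gamma(Y)\cong_{F_r}F_r\oplus M$ for a finitely generated torsion-free module $M$ over $R=k[x_1,\dots,x_r]$. Then $\dim(Y)=r(M)$, the rank of $M$.
   Context: $F_r$ is the free metabelian Lie algebra over $k$ with free base $a_1,\dots,a_r$; $F_r^2$ is an $R$-module via $u\cdot x_i=ua_i$. For a torsion-free $R$-module $M$, $F_r\oplus M$ is the Lie algebra on $F_r\oplus M$ with $F_r$ a subalgebra, $MM=0$, and $mu=-um=m\cdot(\sum\alpha_ix_i)$ for $m\in M$, $u\in F_r$, $u\equiv\sum\alpha_ia_i\bmod F_r^2$; $\cong_{F_r}$ means isomorphism identical on $F_r$. The rank $r(M)$ is the maximal cardinality of an $R$-linearly independent subset of $M$. Algebraic sets: $V(S)=\{p\in F_r^n:f(p)=0\ \forall f\in S\}$ for $S\subseteq F_r[X]=F_r\ast F(x_1,\dots,x_n)$; $\mathrm{Rad}(Y)=\{f\in F_r[X]: f(p)=0\ \forall p\in Y\}$; $\Gamma(Y)=F_r[X]/\mathrm{Rad}(Y)$. Zariski topology: algebraic sets form a sub-basis of closed sets; irreducible means not a union of two closed proper subsets. The dimension $\dim(Y)$ of an irreducible algebraic set $Y$ is the maximal $m$ such that there is a chain $Y=Y_0\supsetneq Y_1\supsetneq\dots\supsetneq Y_m$ of irreducible algebraic sets. *)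

(* Defs.v *)
From HB Require Import structures.
From mathcomp Require Import all_boot all_order all_algebra.
From mathcomp Require Import mpoly.
From Stdlib Require Lists.List.
Set Implicit Arguments. Unset Strict Implicit. Unset Printing Implicit Defensive.
Import GRing.Theory.
Local Open Scope ring_scope.

Section LieDefs.
Variable k : fieldType.

Definition is_lie (V : lmodType k) (br : V -> V -> V) : Prop :=
  (forall x (a : k) u v, br x (a *: u + v) = a *: br x u + br x v) /\
  (forall y (a : k) u v, br (a *: u + v) y = a *: br u y + br v y) /\
  (forall x, br x x = 0) /\
  (forall x y z, br x (br y z) + br y (br z x) + br z (br x y) = 0).

Definition metabelian (V : lmodType k) (br : V -> V -> V) : Prop :=
  forall x y z w, br (br x y) (br z w) = 0.

Definition lie_hom (V W : lmodType k) (brV : V -> V -> V) (brW : W -> W -> W)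
  (f : V -> W) : Prop :=
  (forall (a : k) u v, f (a *: u + v) = a *: f u + f v) /\
  (forall u v, f (brV u v) = brW (f u) (f v)).

Definition is_free_metab (r : nat) (L : lmodType k) (brL : L -> L -> L)
  (a : 'I_r -> L) : Prop :=
  is_lie brL /\ metabelian brL /\
  forall (W : lmodType k) (brW : W -> W -> W), is_lie brW -> metabelian brW ->
  forall w : 'I_r -> W,
    exists h : L -> W, [/\ lie_hom brL brW h, (forall i, h (a i) = w i) &
      forall h' : L -> W, lie_hom brL brW h' -> (forall i, h' (a i) = w i) ->
        forall u, h' u = h u].

(* (P, iota, x) is F_r[X] = F_r * F(x_1,...,x_n): the coproduct of F_r with
   the free metabelian Lie algebra on x_1..x_n in the variety of metabelian
   Lie algebras over k. *)
Definition is_FrX (n : nat) (L : lmodType k) (brL : L -> L -> L)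
  (P : lmodType k) (brP : P -> P -> P) (iota : L -> P) (x : 'I_n -> P) : Prop :=
  is_lie brP /\ metabelian brP /\ lie_hom brL brP iota /\
  forall (W : lmodType k) (brW : W -> W -> W), is_lie brW -> metabelian brW ->
  forall (g : L -> W), lie_hom brL brW g -> forall w : 'I_n -> W,
    exists h : P -> W, [/\ lie_hom brP brW h, (forall u, h (iota u) = g u),
      (forall j, h (x j) = w j) &
      forall h' : P -> W, lie_hom brP brW h' -> (forall u, h' (iota u) = g u) ->
        (forall j, h' (x j) = w j) -> forall f, h' f = h f].

Section Geometry.
Variables (n : nat) (L : lmodType k) (brL : L -> L -> L)
  (P : lmodType k) (brP : P -> P -> P) (iota : L -> P) (x : 'I_n -> P).

Definition pt := 'I_n -> L.
Definition ptset := pt -> Prop.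

Definition ev_hom (p : pt) (h : P -> L) : Prop :=
  [/\ lie_hom brP brL h, (forall u, h (iota u) = u) & (forall j, h (x j) = p j)].

Definition Vset (S : P -> Prop) : ptset :=
  fun p => forall h, ev_hom p h -> forall f, S f -> h f = 0.

Definition algebraic (A : ptset) : Prop :=
  exists S : P -> Prop, forall p, A p <-> Vset S p.

Definition Rad (Y : ptset) : P -> Prop :=
  fun f => forall p, Y p -> forall h, ev_hom p h -> h f = 0.

(* Zariski closed sets: the topology with the algebraic sets as a sub-basis
   of closed sets, i.e. arbitrary intersections of finite unions of
   algebraic sets. *)
Definition zclosed (C : ptset) : Prop :=
  exists Fam : list ptset -> Prop,
    (forall s, Fam s -> forall A, Stdlib.Lists.List.In A s -> algebraic A) /\
    (forall p, C p <-> (forall s, Fam s -> exists A, Stdlib.Lists.List.In A s /\ A p)).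

Definition irreducible (Y : ptset) : Prop :=
  (exists p, Y p) /\
  forall D1 D2 : ptset, zclosed D1 -> zclosed D2 ->
    (forall p, Y p -> D1 p \/ D2 p) ->
    (forall p, Y p -> D1 p) \/ (forall p, Y p -> D2 p).

Definition has_chain (Y : ptset) (m : nat) : Prop :=
  exists Z : nat -> ptset,
    [/\ (forall p, Z 0%N p <-> Y p),
        (forall i, (i <= m)%N -> algebraic (Z i) /\ irreducible (Z i)) &
        (forall i, (i < m)%N ->
           (forall p, Z i.+1 p -> Z i p) /\ (exists p, Z i p /\ ~ Z i.+1 p))].

Definition is_dim (Y : ptset) (d : nat) : Prop :=
  has_chain Y d /\ forall m, has_chain Y m -> (m <= d)%N.

End Geometry.
End LieDefs.

Section Modules.
Variables (k : fieldType) (r : nat).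
Local Notation R := {mpoly k[r]}.

Definition fin_gen (M : lmodType R) : Prop :=
  exists (m : nat) (g : 'I_m -> M),
    forall v : M, exists cf : 'I_m -> R, v = \sum_(i < m) cf i *: g i.

Definition torsion_free (M : lmodType R) : Prop :=
  forall (p : R) (v : M), p *: v = 0 -> p = 0 \/ v = 0.

(* R-linear independence of a finite family (of necessarily distinct elements) *)
Definition lin_indep (M : lmodType R) (m : nat) (v : 'I_m -> M) : Prop :=
  forall cf : 'I_m -> R, \sum_(i < m) cf i *: v i = 0 -> forall i, cf i = 0.

Definition is_rank (M : lmodType R) (d : nat) : Prop :=
  (exists v : 'I_d -> M, lin_indep v) /\
  forall (m : nat) (v : 'I_m -> M), lin_indep v -> (m <= d)%N.

(* c : F_r -> k^r gives the coefficients alpha_i of u = sum alpha_i a_i mod F_r^2 *)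
Definition abel_coords (L : lmodType k) (brL : L -> L -> L) (a : 'I_r -> L)
  (c : L -> 'rV[k]_r) : Prop :=
  [/\ (forall (s : k) u v, c (s *: u + v) = s *: c u + c v),
      (forall u v, c (brL u v) = 0) &
      (forall i, c (a i) = delta_mx 0 i)].

Definition alphaR (L : lmodType k) (c : L -> 'rV[k]_r) (u : L) : R :=
  \sum_(i < r) c u 0 i *: 'X_i.

(* Gamma(Y) = F_r[X]/Rad(Y) is isomorphic, identically on F_r, to the Lie
   algebra F_r (+) M (carrier L * M, bracket
   [(u,m),(v,m')] = ([u,v], m.alpha(v) - m'.alpha(u)), k acting on M through
   the constants of R).  Stated via the first isomorphism theorem: there is a
   surjective Lie homomorphism phi = (phi1, phi2) : F_r[X] -> F_r (+) M with
   kernel Rad(Y) and phi (iota u) = (u, 0). *)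
Definition coord_iso (n : nat) (L : lmodType k) (brL : L -> L -> L)
  (c : L -> 'rV[k]_r)
  (P : lmodType k) (brP : P -> P -> P) (iota : L -> P) (x : 'I_n -> P)
  (Y : ptset n L) (M : lmodType R) : Prop :=
  exists (phi1 : P -> L) (phi2 : P -> M),
    [/\ forall (s : k) f g, phi1 (s *: f + g) = s *: phi1 f + phi1 g
                            /\ phi2 (s *: f + g) = (s%:MP : R) *: phi2 f + phi2 g,
        forall f g, phi1 (brP f g) = brL (phi1 f) (phi1 g) /\
                    phi2 (brP f g) = alphaR c (phi1 g) *: phi2 f
                                     - alphaR c (phi1 f) *: phi2 g,
        forall u, phi1 (iota u) = u /\ phi2 (iota u) = 0,
        forall (u : L) (m : M), exists f, phi1 f = u /\ phi2 f = m &
        forall f, (phi1 f = 0 /\ phi2 f = 0) <-> Rad brL brP iota x Y f].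

End Modules.

(* Main.v *)
(** Points of [Y] correspond to [F_r]-homomorphisms [F_r (+) M -> F_r] identical
    on [F_r], hence to [R]-module homomorphisms [d : M -> F_r^2].  The algebraic
    subsets of [Y] become cosets of the modules of [d] vanishing on a subset of
    [M]; as [F_r^2] is torsion-free and [R] is infinite, no such coset is a
    finite union of smaller ones, so it is irreducible.  In a strictly
    decreasing chain of such sets, the elements of [M] which separate the
    consecutive terms are linearly independent, so the length is at most the
    rank.  Conversely, if [v_1, ..., v_d] is a maximal independent family and
    [D *: M] lies in its span, the coordinates of [D *: m], followed by the map
    [R -> F_r^2] given by [[a_0, a_1]], show that the conditions
    [d v_1 = ... = d v_i = 0] define a strictly decreasing chain.

    That [F_r^2] is torsion-free follows from the injectivity of the Magnus
    embedding [F_r -> k^r (+) R^r], which is obtained from the universal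
    property by means of a contracting homotopy of a Koszul complex. *)
Require Import Defs.
From HB Require Import structures.
From mathcomp Require Import all_boot all_order all_algebra.
From mathcomp Require Import mpoly ring.
From Stdlib Require Import Classical ClassicalEpsilon.
Set Implicit Arguments. Unset Strict Implicit. Unset Printing Implicit Defensive.
Import GRing.Theory.
Local Open Scope ring_scope.

(** * Linear maps over [k] *)

Section Linear.
Variable k : fieldType.

Definition klin (V W : lmodType k) (f : V -> W) : Prop :=
  forall (s : k) u v, f (s *: u + v) = s *: f u + f v.

Section OneMap.
Variables (V W : lmodType k) (f : V -> W).
Hypothesis fL : klin f.

Lemma klinD u v : f (u + v) = f u + f v.
Proof. by have := fL 1 u v; rewrite !scale1r. Qed.

Lemma klin0 : f 0 = 0.
Proof. by apply: (addrI (f 0)); rewrite -klinD !addr0. Qed.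

Lemma klinZ s u : f (s *: u) = s *: f u.
Proof. by rewrite -[s *: u]addr0 fL klin0 addr0. Qed.

Lemma klinN u : f (- u) = - f u.
Proof. by rewrite -scaleN1r klinZ scaleN1r. Qed.

Lemma klinB u v : f (u - v) = f u - f v.
Proof. by rewrite klinD klinN. Qed.

Lemma klin_sum (I : Type) (s : seq I) (Q : pred I) (F : I -> V) :
  f (\sum_(i <- s | Q i) F i) = \sum_(i <- s | Q i) f (F i).
Proof. exact: (big_morph f klinD klin0). Qed.

End OneMap.

Lemma klin_sumf (V W : lmodType k) (I : Type) (s : seq I) (Q : pred I)
    (F : I -> V -> W) :
  (forall i, klin (F i)) -> klin (fun u => \sum_(i <- s | Q i) F i u).
Proof.
move=> FL t u v; rewrite scaler_sumr -big_split /=.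
by apply: eq_bigr => i _; rewrite FL.
Qed.

Lemma klin_addf (V W : lmodType k) (f g : V -> W) :
  klin f -> klin g -> klin (fun u => f u + g u).
Proof. by move=> fL gL t u v; rewrite fL gL scalerDr addrACA. Qed.

Lemma klin_comp (V W Z : lmodType k) (f : W -> Z) (g : V -> W) :
  klin f -> klin g -> klin (fun u => f (g u)).
Proof. by move=> fL gL t u v; rewrite gL fL. Qed.

End Linear.

(** * Linear maps out of the polynomial ring *)

Section LinearExtension.
Variables (k : fieldType) (r : nat).
Local Notation R := {mpoly k[r]}.

Lemma mpoly_mul_klin (p : R) : klin (fun q : R => p * q).
Proof. by move=> s u v; rewrite mulrDr -scalerAr. Qed.

Lemma klin_mpoly_ext (V : lmodType k) (f g : R -> V) :
  klin f -> klin g -> (forall m, f 'X_[m] = g 'X_[m]) -> f =1 g.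
Proof.
move=> fL gL fg q; rewrite [q]mpolyE (klin_sum fL) (klin_sum gL).
by apply: eq_bigr => m _; rewrite (klinZ fL) (klinZ gL) fg.
Qed.

Definition lext (V : lmodType k) (phi : 'X_{1..r} -> V) (q : R) : V :=
  \sum_(m <- msupp q) q@_m *: phi m.

(** Padding the support lets several polynomials be summed over one common list, as the linearity of
    [lext] requires. *)
Lemma lext_supp (V : lmodType k) (phi : 'X_{1..r} -> V) (q : R) s :
  uniq s -> {subset msupp q <= s} -> lext phi q = \sum_(m <- s) q@_m *: phi m.
Proof.
move=> us qs; rewrite [RHS](bigID (mem (msupp q))) /= [X in _ + X]big1 ?addr0.
  rewrite -[RHS]big_filter; apply: perm_big; apply: uniq_perm.
  - exact: msupp_uniq.
  - exact: filter_uniq.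
  by move=> m; rewrite mem_filter; case: (boolP (m \in msupp q)) => // /qs ->.
by move=> m /memN_msupp_eq0 ->; rewrite scale0r.
Qed.

Lemma lext_klin (V : lmodType k) (phi : 'X_{1..r} -> V) : klin (lext phi).
Proof.
move=> t p q; pose s := undup (msupp p ++ msupp q ++ msupp (t *: p + q)).
have us : uniq s by exact: undup_uniq.
rewrite !(@lext_supp _ _ _ s) //; try by
  move=> m mp; rewrite /s mem_undup !mem_cat mp ?orbT.
rewrite scaler_sumr -big_split /=; apply: eq_bigr => m _.
by rewrite mcoeffD mcoeffZ scalerDl scalerA.
Qed.

Lemma lextX (V : lmodType k) (phi : 'X_{1..r} -> V) m : lext phi 'X_[m] = phi m.
Proof. by rewrite /lext msuppX big_seq1 mcoeffX eqxx scale1r. Qed.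

End LinearExtension.

(** * Identities in a Lie algebra *)

Section LieBasics.
Variables (k : fieldType) (V : lmodType k) (br : V -> V -> V).
Hypothesis brLie : is_lie br.

Lemma br_klinr x : klin (br x). Proof. by case: brLie => h _ s u v; apply: h. Qed.
Lemma br_klinl y : klin (br^~ y).
Proof. by case: brLie => _ [h _] s u v; apply: h. Qed.
Lemma brxx x : br x x = 0. Proof. by case: brLie => _ [_ []]. Qed.
Lemma br_jacobi x y z : br x (br y z) + br y (br z x) + br z (br x y) = 0.
Proof. by case: brLie => _ [_ [_]]. Qed.

Lemma brC x y : br x y = - br y x.
Proof.
apply/eqP; rewrite -addr_eq0; apply/eqP; have := brxx (x + y).
by rewrite (klinD (br_klinl _)) !(klinD (br_klinr _)) !brxx addr0 add0r.
Qed.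

(** Right brackets commute up to $[x,[y,z]]$, a term that vanishes when [x] centralizes the derived
    algebra. *)
Lemma br_jacobi' x y z : br (br x y) z = br (br x z) y + br x (br y z).
Proof.
have := br_jacobi x y z; rewrite (brC z (br x y)) (brC y (br z x)) (brC z x).
rewrite (klinN (br_klinl _)) opprK => /eqP; rewrite subr_eq0 => /eqP <-.
by rewrite addrC.
Qed.

End LieBasics.

(** * Linear dependence over an integral domain *)

Section Rank.
Variable R : idomainType.

(** Fraction-free Gaussian elimination, one column at a time. *)
Lemma dependent_rows (g m : nat) (A : 'I_m -> 'I_g -> R) : (g < m)%N ->
  exists cf : 'I_m -> R,
    (exists i, cf i != 0) /\ forall j, \sum_(i < m) cf i * A i j = 0.
Proof.
elim: g m A => [|g IHg] [|m] A // gm.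
  by exists (fun=> 1); split; [exists ord0; apply: oner_neq0|case].
have [/existsP [p Ap]|/existsPn A0] := boolP [exists p, A p ord0 != 0]; last first.
  have [|cf [cf0 cfA]] := IHg m.+1 (fun i j => A i (lift ord0 j)).
    exact: ltnW.
  exists cf; split=> // j; case: (unliftP ord0 j) => [j' ->|->]; first exact: cfA.
  by apply: big1 => i _; move/negPn/eqP: (A0 i) => ->; rewrite mulr0.
(* Cross-multiplying with the pivot row [p] clears column [ord0] without division. *)
pose B i j := A p ord0 * A (lift p i) (lift ord0 j) -
  A (lift p i) ord0 * A p (lift ord0 j).
have [|cf [[i0 cf0] cfA]] := IHg m B; first by [].
(* The other coefficients absorb the pivot, and that of row [p] balances column [ord0]. *)
pose cf' i := if unlift p i is Some i' then cf i' * A p ord0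
  else - \sum_(i' < m) cf i' * A (lift p i') ord0.
exists cf'; split.
  by exists (lift p i0); rewrite /cf' liftK mulf_neq0.
have cf'E j : \sum_(i < m.+1) cf' i * A i j =
    \sum_(i < m) cf i * (A p ord0 * A (lift p i) j - A (lift p i) ord0 * A p j).
  rewrite (bigD1_ord p) //= {1}/cf' unlift_none mulNr mulr_suml -sumrN -big_split /=.
  by apply: eq_bigr => i _; rewrite /cf' liftK; ring.
move=> j; rewrite cf'E; case: (unliftP ord0 j) => [j' ->|->]; first exact: cfA.
by apply: big1 => i _; ring.
Qed.

End Rank.

(** * Rank and denominators in a finitely generated module *)

Section ModuleRank.
Variables (k : fieldType) (r : nat).
Local Notation R := {mpoly k[r]}.
Variable M : lmodType R.

Lemma lin_indep_bound (g m : nat) (e : 'I_g -> M) (v : 'I_m -> M) :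
  (forall u : M, exists cf : 'I_g -> R, u = \sum_(i < g) cf i *: e i) ->
  lin_indep v -> (m <= g)%N.
Proof.
move=> gen indep; rewrite leqNgt; apply/negP => gm.
have [A vA] : exists A : 'I_m -> 'I_g -> R,
    forall i, v i = \sum_(j < g) A i j *: e j.
  exists (fun i => proj1_sig (constructive_indefinite_description _ (gen (v i)))).
  by move=> i; case: constructive_indefinite_description.
have [cf [[i cfi] cfA]] := dependent_rows A gm.
move/eqP: cfi; apply; apply: indep.
under eq_bigr do rewrite vA scaler_sumr.
rewrite exchange_big big1 //= => j _.
under eq_bigr do rewrite scalerA.
by rewrite -scaler_suml cfA scale0r.
Qed.

Lemma is_rank_exists : fin_gen M -> exists d, is_rank M d.
Proof.
move=> [g [e gen]].
pose Q d := exists v : 'I_d -> M, lin_indep v.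
have Q0 : Q 0%N by exists (fun=> 0) => cf _ [].
have [d [Qd dmax]] : exists d, Q d /\ forall m, Q m -> (m <= d)%N.
  have Qg m : Q m -> (m <= g)%N by case=> v; apply: lin_indep_bound gen.
  (* [ex_maxn] searches with a boolean predicate, supplied here by classical logic. *)
  pose q m : bool := excluded_middle_informative (Q m).
  have qP m : reflect (Q m) (q m).
    by rewrite /q; case: excluded_middle_informative => h; constructor.
  have ex : exists m, q m by exists 0%N; apply/qP.
  have ub m : q m -> (m <= g)%N by move/qP/Qg.
  exists (ex_maxn ex ub); case: ex_maxnP => m /qP Qm mmax.
  by split=> // m' /qP; apply: mmax.
by exists d; split=> // m v vI; apply: dmax; exists v.
Qed.

(* Clearing denominators: [D *: M] lies in the span of a maximal independent
   family, and [th i] is the [i]-th coordinate of [D *: m]. *)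
Lemma rank_coordinates d : fin_gen M -> is_rank M d ->
  exists (v : 'I_d -> M) (D : R) (th : 'I_d -> M -> R),
    [/\ lin_indep v, D != 0,
        forall i p m m', th i (p *: m + m') = p * th i m + th i m' &
        forall i j, th i (v j) = (i == j)%:R * D].
Proof.
move=> [g [e gen]] [[v vI] dmax]; exists v.
pose span (u : M) := exists cf : 'I_d -> R, u = \sum_(i < d) cf i *: v i.
have spanZ p u : span u -> span (p *: u).
  case=> cf ->; exists (fun i => p * cf i); rewrite scaler_sumr.
  by apply: eq_bigr => i _; rewrite scalerA.
have spanD u u' : span u -> span u' -> span (u + u').
  move=> [cf ->] [cf' ->]; exists (fun i => cf i + cf' i); rewrite -big_split /=.
  by apply: eq_bigr => i _; rewrite scalerDl.
have span0 : span 0.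
  by exists (fun=> 0); rewrite big1 // => i _; rewrite scale0r.
(* Adjoining [u] to the maximal family creates a relation; its coefficient at [u] is nonzero because
   [v] is independent. *)
have den u : exists D : R, D != 0 /\ span (D *: u).
  pose v' (i : 'I_d.+1) := if unlift ord0 i is Some i' then v i' else u.
  have dep : ~ lin_indep v' by move/dmax; rewrite ltnn.
  have [cf Ncf] := not_all_ex_not _ _ dep.
  have [cf0 Ni] := imply_to_and _ _ Ncf.
  have [i0 cfi0] := not_all_ex_not _ _ Ni.
  have cfE : cf ord0 *: u = - \sum_(i < d) cf (lift ord0 i) *: v i.
    apply/eqP; rewrite -addr_eq0; apply/eqP.
    rewrite -[RHS]cf0 big_ord_recl /v' unlift_none.
    by congr (_ + _); apply: eq_bigr => i _; rewrite liftK.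
  exists (cf ord0); split; last first.
    rewrite cfE; exists (fun i => - cf (lift ord0 i)); rewrite -sumrN.
    by apply: eq_bigr => i _; rewrite scaleNr.
  apply/eqP => cf00; apply: cfi0; case: (unliftP ord0 i0) => [i' ->|-> //].
  move: i'; apply: (vI (fun i => cf (lift ord0 i))).
  by apply/eqP; rewrite -oppr_eq0 -cfE cf00 scale0r.
pose De i := proj1_sig (constructive_indefinite_description _ (den (e i))).
have De0 i : De i != 0.
  by rewrite /De; case: constructive_indefinite_description => ? [].
have spanDe i : span (De i *: e i).
  by rewrite /De; case: constructive_indefinite_description => ? [].
(* The product of the denominators of the generators serves for all of [M]. *)
pose D := \prod_(i < g) De i.
have spanM u : span (D *: u).
  have [cf ->] := gen u; rewrite scaler_sumr.
  elim/big_ind: _ => // i _; rewrite scalerA /D (bigD1 i) //=.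
  by rewrite mulrC mulrCA mulrC -scalerA; apply/spanZ/spanDe.
pose th i u := proj1_sig (constructive_indefinite_description _ (spanM u)) i.
have thE u : D *: u = \sum_(i < d) th i u *: v i.
  by rewrite /th; case: constructive_indefinite_description.
(* Uniqueness of coordinates makes the chosen [th] linear. *)
have uniq_coord cf cf' : \sum_(i < d) cf i *: v i = \sum_(i < d) cf' i *: v i ->
    forall i, cf i = cf' i.
  move=> E i; apply/eqP; rewrite -subr_eq0; apply/eqP; move: i.
  apply: (vI (fun i => cf i - cf' i)).
  by under eq_bigr do rewrite scalerBl; rewrite sumrB E subrr.
exists D, th; split=> //.
- by apply/prodf_neq0 => i _.
- move=> i p m m'; move: i.
  apply: (uniq_coord (fun i => th i (p *: m + m'))
                     (fun i => p * th i m + th i m')).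
  rewrite -thE scalerDr scalerA mulrC -scalerA !thE scaler_sumr -big_split /=.
  by apply: eq_bigr => i _; rewrite scalerDl scalerA.
move=> i j; move: i; apply: (uniq_coord (fun i => th i (v j))
  (fun i => (i == j)%:R * D)); rewrite -thE (bigD1 j) //= eqxx mul1r.
by rewrite big1 ?addr0 // => i /negPf ->; rewrite mul0r scale0r.
Qed.

End ModuleRank.

Lemma pair_ext (A B : Type) (p q : A * B) : p.1 = q.1 -> p.2 = q.2 -> p = q.
Proof. by case: p q => [? ?] [? ?] /= -> ->. Qed.

(** * Fox derivatives on the free metabelian Lie algebra *)

Section FreeMetabelian.
Variables (k : fieldType) (r : nat) (L : lmodType k) (brL : L -> L -> L).
Variables (a : 'I_r -> L) (c : L -> 'rV[k]_r).
Hypotheses (hL : is_free_metab brL a) (hc : abel_coords brL a c).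
Local Notation R := {mpoly k[r]}.
Local Notation al := (alphaR c).

Let brLie : is_lie brL. Proof. by case: hL. Qed.
Let brMet : metabelian brL. Proof. by case: hL => _ []. Qed.

Let cL : klin c. Proof. by case: hc => h _ _ s u v; apply: h. Qed.
Let c_br u v : c (brL u v) = 0. Proof. by case: hc. Qed.
Let c_gen i : c (a i) = delta_mx 0 i. Proof. by case: hc. Qed.

Lemma free_hom_unique (W : lmodType k) (brW : W -> W -> W) (f g : L -> W) :
  is_lie brW -> metabelian brW -> lie_hom brL brW f -> lie_hom brL brW g ->
  (forall i, f (a i) = g (a i)) -> f =1 g.
Proof.
move=> lieW metW fH gH fg u; case: hL => _ [_ /(_ W brW lieW metW)].
move=> /(_ (fun i => g (a i))) [h [_ _ hU]].
by rewrite (hU f) // (hU g).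
Qed.

(* A linear map killing brackets is a homomorphism to an abelian Lie algebra. *)
Lemma linear_unique (V : lmodType k) (f g : L -> V) :
  klin f -> klin g -> (forall u v, f (brL u v) = 0) ->
  (forall u v, g (brL u v) = 0) -> (forall i, f (a i) = g (a i)) -> f =1 g.
Proof.
move=> fL gL f0 g0; apply: (@free_hom_unique V (fun _ _ => 0)).
- by do !split; move=> *; rewrite ?scaler0 ?addr0.
- by [].
- by split=> // u v; rewrite f0.
- by split=> // u v; rewrite g0.
Qed.

Lemma alpha_klin : klin al.
Proof.
move=> s u v; rewrite /alphaR scaler_sumr -big_split /=.
by apply: eq_bigr => i _; rewrite cL !mxE scalerDl scalerA.
Qed.

Lemma alpha_br u v : al (brL u v) = 0.
Proof. by rewrite /alphaR big1 // => i _; rewrite c_br mxE scale0r. Qed.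

Lemma alpha_gen i : al (a i) = 'X_i.
Proof.
rewrite /alphaR (bigD1 i) //= c_gen mxE !eqxx scale1r big1 ?addr0 // => j ji.
by rewrite mxE (negPf ji) andbF scale0r.
Qed.

Lemma alpha_inj u : al u = 0 -> c u = 0.
Proof.
move=> /(congr1 (fun p : R => fun i => p@_U_(i))) u0.
apply/rowP => i; rewrite mxE; have := congr1 (@^~ i) u0.
rewrite mcoeff0 /alphaR raddf_sum (bigD1 i) //= mcoeffZ mcoeffXU eqxx mulr1.
rewrite big1 ?addr0 // => j ji.
by rewrite mcoeffZ mcoeffXU (negPf ji) mulr0.
Qed.

(** Semidirect product of [L] with the abelian ideal [R], on which [u] acts through [al u]. A linear
    [mu] obeys the derivation rule of [fox_exists] exactly when [u |-> (u, mu u)] is a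
    homomorphism. *)
Definition fox_br (p q : (L * R)%type) : (L * R)%type :=
  (brL p.1 q.1, al q.1 * p.2 - al p.1 * q.2).

Lemma fox_br_lie : is_lie fox_br.
Proof.
split; [|split; [|split]].
- move=> [x f] s [u g] [v h]; apply: pair_ext => /=; first exact: br_klinr.
  rewrite alpha_klin mulrDl mulrDr opprD -scalerAl -scalerAr scalerBr.
  by rewrite addrACA.
- move=> [x f] s [u g] [v h]; apply: pair_ext => /=; first exact: (br_klinl brLie).
  rewrite alpha_klin mulrDl mulrDr opprD -scalerAl -scalerAr scalerBr.
  by rewrite addrACA.
- by move=> [x f]; apply: pair_ext => /=; rewrite ?subrr ?brxx.
move=> [x f] [y g] [z h]; apply: pair_ext => /=; first exact: br_jacobi.
by rewrite !alpha_br; ring.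
Qed.

Lemma fox_br_metab : metabelian fox_br.
Proof.
move=> [x f] [y g] [z h] [w i]; apply: pair_ext => /=; first exact: brMet.
by rewrite !alpha_br !mul0r subrr.
Qed.

(* Fox derivatives, i.e. the Magnus embedding of [L] into [k^r (+) R^r]. *)
Lemma fox_exists (i : 'I_r) : exists mu : L -> R,
  [/\ klin mu, forall u v, mu (brL u v) = al v * mu u - al u * mu v &
      forall j, mu (a j) = (i == j)%:R].
Proof.
case: hL => _ [_ /(_ _ _ fox_br_lie fox_br_metab)].
move=> /(_ (fun j => (a j, (i == j)%:R))) [h [[hlin hbr] ha _]].
(* The first component is an endomorphism fixing the generators, hence the identity. *)
have h1 u : (h u).1 = u.
  apply: (@free_hom_unique L brL (fun u => (h u).1) id) => //.
  - by split=> [s v w|v w]; rewrite ?hlin ?hbr.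
  - by move=> j; rewrite ha.
exists (fun u => (h u).2); split.
- by move=> s u v; rewrite hlin.
- by move=> u v; rewrite hbr /= !h1.
- by move=> j; rewrite ha.
Qed.

Definition fox (i : 'I_r) : L -> R :=
  proj1_sig (constructive_indefinite_description _ (fox_exists i)).

Lemma fox_klin i : klin (fox i).
Proof. by rewrite /fox; case: constructive_indefinite_description => ? []. Qed.

Lemma fox_br_eq i u v : fox i (brL u v) = al v * fox i u - al u * fox i v.
Proof. by rewrite /fox; case: constructive_indefinite_description => ? []. Qed.

Lemma fox_gen i j : fox i (a j) = (i == j)%:R.
Proof. by rewrite /fox; case: constructive_indefinite_description => ? []. Qed.

(** The maps [u |-> (u, d u)] and [u |-> (u, 0)] are homomorphisms into the semidirect product that
    agree on generators. *)
Lemma fox_derivation_eq0 (d : L -> R) :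
  klin d -> (forall u v, d (brL u v) = al v * d u - al u * d v) ->
  (forall j, d (a j) = 0) -> forall u, d u = 0.
Proof.
move=> dL dB d0 u.
suff /(congr1 snd) : (u, d u) = (u, 0) by [].
apply: (@free_hom_unique _ fox_br (fun u => (u, d u)) (fun u => (u, 0))).
- exact: fox_br_lie.
- exact: fox_br_metab.
- by split=> [s x y|x y]; rewrite ?dL ?dB.
- by split=> [s x y|x y]; apply: pair_ext; rewrite /= ?scaler0 ?addr0 ?mulr0 ?subr0.
by move=> i; rewrite d0.
Qed.

(** The fundamental formula of Fox calculus. Both sides obey the derivation rule, so it suffices to
    compare them on generators. *)
Lemma fox_euler u : \sum_(i < r) 'X_i * fox i u = al u.
Proof.
apply/eqP; rewrite -subr_eq0; apply/eqP; move: u; apply: fox_derivation_eq0.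
- have FL : klin (fun u => \sum_(i < r) ('X_i : R) * fox i u).
    by apply: klin_sumf => i; apply: (klin_comp (mpoly_mul_klin _) (fox_klin i)).
  by move=> s x y; rewrite FL alpha_klin scalerBr opprD addrACA.
- move=> u v; rewrite alpha_br subr0.
  rewrite (eq_bigr (fun i => al v * ('X_i * fox i u) - al u * ('X_i * fox i v))).
    by rewrite sumrB -!mulr_sumr; set A := \sum_(i < r) _; set B := \sum_(i < r) _; ring.
  by move=> i _; rewrite fox_br_eq; ring.
move=> j; rewrite alpha_gen (bigD1 j) //= fox_gen eqxx mulr1.
by rewrite big1 ?addr0 ?subrr // => i ij; rewrite fox_gen (negPf ij) mulr0.
Qed.

(** * Elements centralizing the derived algebra *)

Definition centr (z : L) : Prop := forall v w, brL z (brL v w) = 0.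

Lemma centr_br u v : centr (brL u v). Proof. by move=> x y; apply: brMet. Qed.

Lemma centr0 : centr 0.
Proof. by move=> v w; rewrite (klin0 (br_klinl brLie _)). Qed.

Lemma centr_lin s u v : centr u -> centr v -> centr (s *: u + v).
Proof.
by move=> cu cv x y; rewrite (br_klinl brLie) cu cv scaler0 addr0.
Qed.

Lemma centr_sum (I : Type) (s : seq I) (F : I -> L) (b : I -> k) :
  (forall i, centr (F i)) -> centr (\sum_(i <- s) b i *: F i).
Proof.
move=> cF; elim/big_rec: _ => [|i x _ cx]; first exact: centr0.
exact: centr_lin.
Qed.

(** Since [z] centralizes the derived algebra, $u \mapsto [z,u]$ factors through the
    abelianization. *)
Lemma br_centr z u : centr z -> brL z u = \sum_(i < r) c u 0 i *: brL z (a i).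
Proof.
move=> cz; move: u; apply: linear_unique => //.
- exact: br_klinr.
- apply: klin_sumf => i s u v.
  by rewrite cL !mxE scalerDl scalerA.
- by move=> u v; rewrite big1 // => i _; rewrite c_br mxE scale0r.
move=> i; rewrite (bigD1 i) //= c_gen mxE !eqxx scale1r big1 ?addr0 // => j ji.
by rewrite mxE (negPf ji) andbF scale0r.
Qed.

Hypothesis hr : (2 <= r)%N.
Let o0 : 'I_r := Ordinal (ltnW hr).
Let o1 : 'I_r := Ordinal hr.

Definition comm01 : L := brL (a o0) (a o1).

Lemma fox_comm01 : fox o0 comm01 = 'X_o1.
Proof. by rewrite /comm01 fox_br_eq !fox_gen !alpha_gen eqxx mulr1 mulr0 subr0. Qed.

Lemma mpolyXU_neq0 (i : 'I_r) : ('X_i : R) != 0.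
Proof.
by apply/eqP => /(congr1 (mcoeff U_(i)))/eqP; rewrite mcoeffXU eqxx mcoeff0 oner_eq0.
Qed.

(** Applying [fox o0] to $[z,[a_0,a_1]] = 0$ leaves, up to sign, [al z * 'X_o1 = 0] in a domain. *)
Lemma centr_alpha z : centr z -> al z = 0.
Proof.
move=> cz; have := congr1 (fox o0) (cz (a o0) (a o1)).
rewrite (klin0 (fox_klin _)) fox_br_eq alpha_br mul0r sub0r fox_comm01.
by move/eqP; rewrite oppr_eq0 mulf_eq0 (negPf (mpolyXU_neq0 _)) orbF => /eqP.
Qed.

Lemma br_centr_centr z u : centr z -> centr u -> brL z u = 0.
Proof.
move=> cz cu; rewrite br_centr // (alpha_inj (centr_alpha cu)).
by rewrite big1 // => i _; rewrite mxE scale0r.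
Qed.

Lemma br_gen_comm z i j : centr z ->
  brL (brL z (a i)) (a j) = brL (brL z (a j)) (a i).
Proof. by move=> cz; rewrite (br_jacobi' brLie) cz addr0. Qed.

(** The list is explicit so that facts about the monomial action [actm] can be proved by induction
    over the variables. *)
Definition acts (s : seq 'I_r) (m : 'I_r -> nat) (z : L) : L :=
  foldr (fun i v => iter (m i) (fun u => brL u (a i)) v) z s.

Definition actm (m : 'X_{1..r}) : L -> L := acts (enum 'I_r) m.

Lemma centr_iter n i z : centr z -> centr (iter n (fun u => brL u (a i)) z).
Proof. by move=> ?; elim: n => //= n _; apply: centr_br. Qed.

Lemma centr_acts s m z : centr z -> centr (acts s m z).
Proof. by move=> cz; elim: s => //= i s; apply: centr_iter. Qed.

Lemma centr_actm m z : centr z -> centr (actm m z).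
Proof. exact: centr_acts. Qed.

Lemma iter_br_comm n i z j : centr z ->
  iter n (fun u => brL u (a i)) (brL z (a j)) =
  brL (iter n (fun u => brL u (a i)) z) (a j).
Proof.
move=> cz; elim: n => //= n ->; apply: br_gen_comm; exact: centr_iter.
Qed.

Lemma actm0 z : actm 0%MM z = z.
Proof. by rewrite /actm /acts; elim: (enum _) => //= i s ->; rewrite mnm0E. Qed.

Lemma actm_klin m : klin (actm m).
Proof.
rewrite /actm /acts; elim: (enum _) => // i s IHs x u v /=; rewrite IHs.
by elim: (m i) => //= n ->; rewrite (br_klinl brLie).
Qed.

Lemma acts_br s m z j : centr z -> acts s m (brL z (a j)) = brL (acts s m z) (a j).
Proof.
by move=> cz; elim: s => //= i s ->; rewrite iter_br_comm //; apply: centr_acts.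
Qed.

Lemma actm_br m z j : centr z -> actm m (brL z (a j)) = brL (actm m z) (a j).
Proof. exact: acts_br. Qed.

Lemma eq_acts s m m' z : {in s, m =1 m'} -> acts s m z = acts s m' z.
Proof.
elim: s => //= i s IHs mm; rewrite mm ?mem_head // IHs // => j js.
by apply: mm; rewrite inE js orbT.
Qed.

(** The extra factor appears at the entry [j] of the list and is moved outwards past the others,
    since right brackets with generators commute on centralizing elements. *)
Lemma actmU m z j : centr z -> actm (m + U_(j))%MM z = brL (actm m z) (a j).
Proof.
move=> cz; have : uniq (enum 'I_r) := enum_uniq _.
have : j \in enum 'I_r by rewrite mem_enum.
rewrite /actm; elim: (enum _) => //= i s IHs.
rewrite inE mnmDE mnm1E => /orP [/eqP <-|js] /andP [ins us].
  rewrite eqxx addn1 /=; congr (brL (iter _ _ _) _).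
  apply: eq_acts => l ls; rewrite mnmDE mnm1E.
  by rewrite (_ : j == l = false) ?addn0 //; apply: contraNF ins => /eqP ->.
have /negPf -> : j != i by apply: contraNneq ins => <-.
by rewrite addn0 IHs // iter_br_comm //; apply: centr_acts.
Qed.

(** * Leading variables and the contracting homotopy *)

Definition lead (m : 'X_{1..r}) : option 'I_r :=
  [pick l | (m l != 0%N) && [forall i : 'I_r, (i < l)%N ==> (m i == 0%N)]].

Lemma lead_some (m : 'X_{1..r}) (l : 'I_r) :
  m l != 0%N -> (forall i : 'I_r, (i < l)%N -> m i = 0%N) -> lead m = Some l.
Proof.
move=> ml lt0; rewrite /lead; case: pickP => [l' /andP [ml' /forallP lt0']|].
  congr Some; apply: ord_inj; case: (ltngtP l' l) => // [/lt0 h|h].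
    by rewrite h in ml'.
  by move: (lt0' l); rewrite h (negPf ml).
move/(_ l); rewrite ml /= => /negP [].
by apply/forallP => i; apply/implyP => /lt0 ->.
Qed.

Variant lead_spec (m : 'X_{1..r}) : option 'I_r -> Prop :=
| LeadSome l of m l != 0%N & (forall i : 'I_r, (i < l)%N -> m i = 0%N) :
    lead_spec m (Some l)
| LeadNone of m = 0%MM : lead_spec m None.

Lemma leadP m : lead_spec m (lead m).
Proof.
have [[l ml]|m0] := classic (exists l, m l != 0%N); last first.
  have -> : m = 0%MM.
    apply/mnmP => l; rewrite mnm0E; apply/eqP/negPn/negP => ml.
    by apply: m0; exists l.
  rewrite /lead; case: pickP => [l|_]; last by constructor.
  by rewrite mnm0E.
case: (arg_minnP (P := [pred l | m l != 0%N]) (fun l : 'I_r => val l) ml).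
move=> {ml}l /= ml lmin.
have lt0 (i : 'I_r) : (i < l)%N -> m i = 0%N.
  by move=> il; apply/eqP/negPn/negP => /lmin; rewrite leqNgt il.
by rewrite (lead_some ml lt0); constructor.
Qed.

Lemma leadU m j : lead (m + U_(j))%MM =
  if lead m is Some l then Some (if (j <= l)%N then j else l) else Some j.
Proof.
case: (leadP m) => [l ml lt0|->]; last first.
  apply: lead_some => [|i ij]; rewrite mnmDE mnm0E mnm1E ?eqxx //.
  by rewrite (_ : j == i = false) //; apply: contraTF ij => /eqP ->; rewrite ltnn.
apply: lead_some => [|i]; rewrite mnmDE mnm1E.
  by case: ifP; rewrite ?eqxx ?addn1 // addn_eq0 negb_and ml.
case: (leqP j l) => [jl ij|lj il].
  rewrite lt0 ?(leq_trans ij) // (_ : j == i = false) //.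
  by apply: contraTF ij => /eqP ->; rewrite ltnn.
rewrite lt0 // (_ : j == i = false) //.
by apply: contraTF (ltn_trans il lj) => /eqP ->; rewrite ltnn.
Qed.

(* [kos] inverts the Magnus embedding on normal forms: the basis commutator
   [a_i, a_l] x^b with l < i and l <= min (supp b) has the leading Magnus
   coordinate x_l x^b e_i.  It is a contracting homotopy of a Koszul complex,
   see [kosX]. *)
Definition kos_mon (i : 'I_r) (m : 'X_{1..r}) : L :=
  if lead m is Some l then
    if (l < i)%N then actm (m - U_(l))%MM (brL (a i) (a l)) else 0
  else 0.
Definition kos i : R -> L := lext (kos_mon i).

(** The correction by which [kos] fails to turn multiplication by ['X_j] into the bracket with
    [a j]. *)
Definition cokos_mon (j : 'I_r) (m : 'X_{1..r}) : L :=
  if lead m is Some l then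
    if (j < l)%N then actm (m - U_(l))%MM (brL (a l) (a j)) else 0
  else 0.
Definition cokos j : R -> L := lext (cokos_mon j).

Lemma kos_klin i : klin (kos i). Proof. exact: lext_klin. Qed.
Lemma cokos_klin j : klin (cokos j). Proof. exact: lext_klin. Qed.

(** Let [l] be the least variable of [m]. For [j < l < i] this is the Jacobi identity for [a i],
    [a j], [a l]; otherwise at least one summand on the right is zero. *)
Lemma kos_monU i j m :
  kos_mon i (m + U_(j))%MM = brL (kos_mon i m) (a j) + cokos_mon j (m + U_(i))%MM.
Proof.
have br0 u : brL 0 u = 0 by exact: klin0 (br_klinl brLie u).
have cc := centr_br.
rewrite /kos_mon /cokos_mon !leadU.
case: (leadP m) => [l ml lt0|->]; last by rewrite !addmK br0 add0r.
have [m' ->] : exists m', m = (m' + U_(l))%MM.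
  by exists (m - U_(l))%MM; rewrite submK // lep1mP.
have mUl q : (m' + U_(l) + U_(q) - U_(l))%MM = (m' + U_(q))%MM.
  by rewrite -addmA [(U_(l) + _)%MM]addmC addmA addmK.
case: (leqP j l) => jl; case: (leqP i l) => il; rewrite !addmK ?mUl.
- by rewrite br0 add0r.
- have -> : (j < i)%N := leq_ltn_trans jl il.
  move: jl; rewrite leq_eqVlt => /orP [/eqP/ord_inj ->|jl].
    by rewrite ltnn addr0 actmU.
  rewrite jl !actmU // -!actm_br // -(klinD (actm_klin _)).
  congr (actm _ _).
  rewrite (br_jacobi' brLie) [brL (a j) _](brC brLie).
  by rewrite (klinN (br_klinr brLie _)) -(brC brLie).
- by rewrite br0 add0r ltnNge (leq_trans il (ltnW jl)).
- by rewrite actmU // ltnNge (ltnW jl) addr0.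
Qed.

Lemma kosX i j q : kos i ('X_j * q) = brL (kos i q) (a j) + cokos j ('X_i * q).
Proof.
apply: (klin_mpoly_ext (f := fun q => kos i ('X_j * q))
  (g := fun q => brL (kos i q) (a j) + cokos j ('X_i * q))).
- exact: klin_comp (lext_klin _) (mpoly_mul_klin _).
- apply: klin_addf.
    exact: (klin_comp (br_klinl brLie (a j)) (lext_klin _)).
  exact: klin_comp (lext_klin _) (mpoly_mul_klin _).
move=> m; rewrite -!mpolyXD /kos /cokos !lextX ![(U_(_) + m)%MM]addmC.
exact: kos_monU.
Qed.

Lemma cokosX j i : cokos j 'X_i = if (j < i)%N then brL (a i) (a j) else 0.
Proof.
rewrite /cokos lextX /cokos_mon -[U_(i)%MM]add0m leadU.
by case: (leadP 0%MM) => [l|_]; rewrite ?mnm0E // addmK actm0.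
Qed.

Lemma centr_kos i q : centr (kos i q).
Proof.
apply: centr_sum => m; rewrite /kos_mon; case: (lead m) => [l|]; last exact: centr0.
by case: ifP => _; [apply/centr_actm/centr_br|apply: centr0].
Qed.

(** * Injectivity of the Magnus embedding *)

Definition kosT (u : L) : L := \sum_(i < r) kos i (fox i u).
Definition barT (u : L) : L := \sum_(i < r) c u 0 i *: a i.

Lemma centr_kosT u : centr (kosT u).
Proof.
rewrite /kosT -(eq_bigr _ (fun i _ => scale1r (kos i (fox i u)))).
by apply: centr_sum => i; apply: centr_kos.
Qed.

Lemma kosT_klin : klin kosT.
Proof. by apply: klin_sumf => i; apply: klin_comp (lext_klin _) (fox_klin i). Qed.

Lemma barT_klin : klin barT.
Proof.
by apply: klin_sumf => i s u v; rewrite cL !mxE scalerDl scalerA.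
Qed.

Lemma br_barT z v : centr z -> brL z (barT v) = brL z v.
Proof.
move=> cz; rewrite [RHS]br_centr // (klin_sum (br_klinr brLie z)).
by apply: eq_bigr => i _; rewrite (klinZ (br_klinr brLie z)).
Qed.

(** The terms with [j < i] in the expansion of the bracket of [barT u] and [barT v]. *)
Definition halfbr (u v : L) : L :=
  \sum_(j < r) \sum_(i < r | (j < i)%N) (c v 0 j * c u 0 i) *: brL (a i) (a j).

(** Expanding [al v] by [kosX] gives the bracket with [v] plus [cokos] terms; [fox_euler] sums the
    latter to values of [cokos j] at [al u], which [cokosX] evaluates. *)
Lemma kos_alpha u v :
  \sum_(i < r) kos i (al v * fox i u) = brL (kosT u) v + halfbr u v.
Proof.
rewrite (eq_bigr (fun i => \sum_(j < r) (c v 0 j *: brL (kos i (fox i u)) (a j) +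
  c v 0 j *: cokos j ('X_i * fox i u)))); last first.
  move=> i _; rewrite /alphaR mulr_suml (klin_sum (kos_klin i)); apply: eq_bigr => j _.
  by rewrite -scalerAl (klinZ (kos_klin i)) kosX scalerDr.
rewrite exchange_big /=.
rewrite (br_centr _ (centr_kosT u)) -big_split /=; apply: eq_bigr => j _.
rewrite big_split /= -!scaler_sumr; congr (_ *: _ + _).
  by rewrite -(klin_sum (br_klinl brLie (a j))).
rewrite -(klin_sum (cokos_klin j)) fox_euler /alphaR.
rewrite (klin_sum (cokos_klin j)) scaler_sumr [RHS]big_mkcond /=.
apply: eq_bigr => i _; rewrite (klinZ (cokos_klin j)).
by rewrite cokosX scalerA; case: ifP; rewrite ?scaler0.
Qed.

Lemma br_bar u v : brL (barT u) (barT v) = halfbr u v - halfbr v u.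
Proof.
have -> : brL (barT u) (barT v) =
    \sum_(j < r) \sum_(i < r) (c v 0 j * c u 0 i) *: brL (a i) (a j).
  rewrite /barT (klin_sum (br_klinr brLie _)); apply: eq_bigr => j _.
  rewrite (klinZ (br_klinr brLie _)) (klin_sum (br_klinl brLie _)) scaler_sumr.
  by apply: eq_bigr => i _; rewrite (klinZ (br_klinl brLie _)) scalerA.
have -> : - halfbr v u =
    \sum_(j < r) \sum_(i < r | (i < j)%N) (c v 0 j * c u 0 i) *: brL (a i) (a j).
  rewrite /halfbr (exchange_big_dep predT) //= -sumrN; apply: eq_bigr => j _.
  rewrite -sumrN; apply: eq_bigr => i _.
  by rewrite mulrC (brC brLie (a i)) scalerN.
rewrite -big_split /=; apply: eq_bigr => j _.
rewrite (bigID (fun i : 'I_r => (j < i)%N)) /=; congr (_ + _).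
rewrite [LHS](bigID (fun i : 'I_r => (i < j)%N)) /= [X in _ + X]big1 ?addr0.
  by apply: eq_bigl => i; rewrite -leqNgt andb_idl // => /ltnW.
move=> i; case: ltngtP => // /ord_inj -> _.
by rewrite brxx // scaler0.
Qed.

(** The left side is an endomorphism fixing the generators: the [halfbr] terms from [kos_alpha]
    combine to the bracket of the linear parts. By [fox_euler] it depends only on the Fox
    derivatives of [u], which therefore determine [u]. *)
Lemma magnus_section u : barT u + kosT u = u.
Proof.
apply: (@free_hom_unique L brL (fun u => barT u + kosT u) id) => //.
- split=> [|v w]; first exact: klin_addf barT_klin kosT_klin.
  have -> : barT (brL v w) = 0.
    by apply: big1 => i _; rewrite c_br mxE scale0r.
  rewrite add0r /kosT (eq_bigr (fun i =>
    kos i (al w * fox i v) - kos i (al v * fox i w))); last first.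
    by move=> i _; rewrite fox_br_eq; apply: (klinB (kos_klin i)).
  rewrite sumrB !kos_alpha -/(kosT v) -/(kosT w).
  rewrite !(klinD (br_klinl brLie _)) !(klinD (br_klinr brLie _)).
  rewrite (br_centr_centr (centr_kosT v) (centr_kosT w)) addr0 br_bar.
  rewrite (brC brLie (barT v)) !br_barT; try exact: centr_kosT.
  by rewrite opprD addrACA -[RHS]addrA [RHS]addrC [X in _ = X + _]addrC.
move=> j; rewrite /barT /kosT [X in _ + X]big1 ?addr0.
  rewrite (bigD1 j) //= c_gen mxE !eqxx scale1r big1 ?addr0 // => i ij.
  by rewrite mxE (negPf ij) andbF scale0r.
move=> i _; rewrite fox_gen; case: (i == j); last exact: klin0 (kos_klin i).
rewrite -mpolyX0 /kos lextX /kos_mon.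
by case: (leadP 0%MM) => [l|//]; rewrite mnm0E.
Qed.

Lemma fox_inj u : (forall i, fox i u = 0) -> u = 0.
Proof.
move=> u0; rewrite -(magnus_section u) /barT /kosT.
have au : al u = 0 by rewrite -fox_euler big1 // => i _; rewrite u0 mulr0.
rewrite !big1 ?addr0 // => i _; last by rewrite (alpha_inj au) mxE scale0r.
by rewrite u0 (klin0 (kos_klin i)).
Qed.

(** * The embedding of [R] into the derived algebra by $1 \mapsto [a_0,a_1]$ *)

Definition act (q : R) : L := lext (fun m => actm m comm01) q.

Lemma act_klin : klin act. Proof. exact: lext_klin. Qed.

Lemma act1 : act 1 = comm01.
Proof. by rewrite -mpolyX0 /act lextX actm0. Qed.

Lemma centr_act q : centr (act q).
Proof. by apply: centr_sum => m; apply/centr_actm/centr_br. Qed.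

Lemma act_br q u : brL (act q) u = act (al u * q).
Proof.
rewrite (br_centr u (centr_act q)) /alphaR mulr_suml (klin_sum act_klin).
apply: eq_bigr => j _; rewrite -scalerAl (klinZ act_klin); congr (_ *: _).
apply: (klin_mpoly_ext (f := fun q => brL (act q) (a j))
  (g := fun q => act ('X_j * q))).
- exact: klin_comp (br_klinl brLie (a j)) act_klin.
- exact: klin_comp act_klin (mpoly_mul_klin _).
move=> m; rewrite -mpolyXD addmC /act !lextX actmU //; exact: centr_br.
Qed.

(** * Module homomorphisms into the derived algebra *)

Section ModuleHom.
Variable M : lmodType R.

(* [R]-linearity of [d : M -> L^2], where ['X_i] acts on [L^2] as the right
   bracket with [a i]; the values of [d] centralize [L^2] automatically. *)
Definition mod_hom (d : M -> L) : Prop :=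
  (forall (s : k) m m', d ((s%:MP : R) *: m + m') = s *: d m + d m') /\
  (forall m u, brL (d m) u = d (al u *: m)).

Variable d : M -> L.
Hypothesis dH : mod_hom d.

Lemma mod_homD m m' : d (m + m') = d m + d m'.
Proof. by have := dH.1 1 m m'; rewrite !scale1r. Qed.

Lemma mod_hom0 : d 0 = 0.
Proof. by apply: (addrI (d 0)); rewrite -mod_homD !addr0. Qed.

Lemma mod_homZ (s : k) m : d ((s%:MP : R) *: m) = s *: d m.
Proof. by have := dH.1 s m 0; rewrite mod_hom0 !addr0. Qed.

Lemma mod_homB m m' : d (m - m') = d m - d m'.
Proof. by apply/eqP; rewrite eq_sym subr_eq -mod_homD subrK. Qed.

Lemma mod_hom_sum (I : Type) (s : seq I) (F : I -> M) :
  d (\sum_(i <- s) F i) = \sum_(i <- s) d (F i).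
Proof. exact: (big_morph d mod_homD mod_hom0). Qed.

Lemma mod_hom_centr m : centr (d m).
Proof. by move=> v w; rewrite dH.2 alpha_br scale0r mod_hom0. Qed.

Lemma mod_hom_alpha m : al (d m) = 0.
Proof. exact/centr_alpha/mod_hom_centr. Qed.

(** Scaling by ['X_j] is the bracket with [a j], which the Fox derivative turns into multiplication
    because [al (d m) = 0]; powers, monomials and linear combinations follow. *)
Lemma mod_hom_fox i p m : fox i (d (p *: m)) = p * fox i (d m).
Proof.
have mulX (j : 'I_r) n z : fox i (d (('X_j ^+ n : R) *: z)) = 'X_j ^+ n * fox i (d z).
  elim: n z => [|n IHn] z; first by rewrite !expr0 scale1r mul1r.
  rewrite exprSr -scalerA IHn -(alpha_gen j) -dH.2 fox_br_eq mod_hom_alpha.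
  by rewrite mul0r subr0 mulrA alpha_gen.
have mulXm (q : 'X_{1..r}) z : fox i (d (('X_[q] : R) *: z)) = 'X_[q] * fox i (d z).
  rewrite mpolyXE_id; elim: (index_enum _) z => [|j s IHs] z.
    by rewrite big_nil scale1r mul1r.
  by rewrite big_cons -scalerA mulX IHs mulrA.
rewrite {1}[p]mpolyE scaler_suml mod_hom_sum (klin_sum (fox_klin i)).
rewrite [p in RHS]mpolyE mulr_suml; apply: eq_bigr => q _.
rewrite -mul_mpolyC -scalerA mod_homZ (klinZ (fox_klin i)) mulXm.
by rewrite mul_mpolyC scalerAl.
Qed.

Lemma mod_hom_scale0 p m : d m = 0 -> d (p *: m) = 0.
Proof.
move=> dm; apply: fox_inj => i.
by rewrite mod_hom_fox dm (klin0 (fox_klin i)) mulr0.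
Qed.

(** Injectivity of the Fox derivatives transfers the absence of torsion from the domain [R]. *)
Lemma mod_hom_torsion_free p m : d (p *: m) = 0 -> p = 0 \/ d m = 0.
Proof.
move=> dpm; have [->|/eqP p0] := classic (p = 0); first by left.
right; apply: fox_inj => i; have := mod_hom_fox i p m.
by rewrite dpm (klin0 (fox_klin i)) => /esym/eqP; rewrite mulf_eq0 (negPf p0) => /eqP.
Qed.

End ModuleHom.

Lemma act_mod_hom (M : lmodType R) (th : M -> R) :
  (forall p m m', th (p *: m + m') = p * th m + th m') ->
  mod_hom (fun m => act (th m)).
Proof.
move=> thL; split=> [s m m'|m u].
  by rewrite thL mul_mpolyC act_klin.
have th0 : th 0 = 0.
  apply: (addrI (th 0)); have := thL 1 0 0.
  by rewrite scale1r addr0 mul1r => <-; rewrite addr0.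
by rewrite act_br -[_ *: m]addr0 thL th0 addr0.
Qed.

Lemma act_eq0 q : act q = 0 -> q = 0.
Proof.
(* Over $M = R$, [q] is [q] times [1], so the derivative of [act q] is [q * 'X_o1]. *)
have H : @mod_hom R^o act by apply: (@act_mod_hom R^o id).
move=> q0; have := mod_hom_fox H o0 q 1.
rewrite (_ : q *: (1 : R^o) = q) ?q0; last exact: mulr1.
rewrite (klin0 (fox_klin _)) act1 fox_comm01 => /esym/eqP.
by rewrite mulf_eq0 (negPf (mpolyXU_neq0 _)) orbF => /eqP.
Qed.

Section MoreModuleHom.
Variable M : lmodType R.

Lemma mod_hom_zero : @mod_hom M (fun=> 0).
Proof.
by split=> [s m m'|m u]; rewrite ?scaler0 ?addr0 ?(klin0 (br_klinl brLie _)).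
Qed.

(** Multiplication by [t] is an endomorphism of [M], as [R] is commutative. These maps form the
    lines used for irreducibility. *)
Lemma mod_hom_shift (d e : M -> L) t :
  mod_hom d -> mod_hom e -> mod_hom (fun m => d m + e (t *: m)).
Proof.
move=> dH eH; split=> [s m m'|m u].
  rewrite dH.1 scalerDr scalerA mulrC -scalerA eH.1.
  by rewrite scalerDr addrACA.
by rewrite (klinD (br_klinl brLie u)) dH.2 eH.2 !scalerA mulrC.
Qed.

Lemma mod_hom_sub (d e : M -> L) :
  mod_hom d -> mod_hom e -> mod_hom (fun m => d m - e m).
Proof.
move=> dH eH; split=> [s m m'|m u].
  by rewrite dH.1 eH.1 scalerBr opprD addrACA.
by rewrite (klinB (br_klinl brLie u)) dH.2 eH.2.
Qed.

(** In a nontrivial relation, apply [d l] for the largest [l] with nonzero coefficient: only the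
    term [l] survives, and it is nonzero for lack of torsion. *)
Lemma triangular_lin_indep m (v : 'I_m -> M) (d : 'I_m -> M -> L) :
  (forall i, mod_hom (d i)) -> (forall i, d i (v i) <> 0) ->
  (forall i j : 'I_m, (j < i)%N -> d i (v j) = 0) -> lin_indep v.
Proof.
move=> dH dii dij cf cf0 i; apply/eqP/negPn/negP => cfi.
case: (arg_maxnP (P := fun i => cf i != 0) (fun i : 'I_m => val i) cfi).
move=> {cfi} l cfl lmax.
have := congr1 (d l) cf0; rewrite mod_hom0 // mod_hom_sum // (bigD1 l) //=.
rewrite big1 ?addr0 => [/(mod_hom_torsion_free (dH l)) [/eqP|]|j jl].
- by rewrite (negPf cfl).
- exact: dii.
case: (ltngtP j l) => [jl'|lj|/ord_inj jE].
- by apply: mod_hom_scale0 => //; apply: dij.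
- have [->|cfj] := eqVneq (cf j) 0; first by rewrite scale0r mod_hom0.
  by have := lmax j cfj; rewrite /= leqNgt lj.
- by rewrite jE eqxx in jl.
Qed.

End MoreModuleHom.

(** Each [B] contains [g e] for at most one index [e], so the forbidden indices are bounded. *)
Lemma cofinitely_many_avoid (T : Type) (g : nat -> T) (Bs : list (T -> Prop)) :
  injective g ->
  (forall B, Lists.List.In B Bs -> forall t t', B t -> B t' -> t = t') ->
  exists N, forall e, (N <= e)%N -> forall B, Lists.List.In B Bs -> ~ B (g e).
Proof.
move=> gI; elim: Bs => [|B Bs IH] BsP; first by exists 0%N.
have [|N NP] := IH; first by move=> B' inB'; apply: BsP; right.
have [[e0 Be0]|noB] := classic (exists e, B (g e)); last first.
  exists N => e Ne B' [<- Be|]; last exact: NP.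
  by apply: noB; exists e.
exists (maxn N e0.+1) => e; rewrite geq_max => /andP [Ne e0e] B' [<- Be|]; last first.
  exact: NP.
have /gI E := BsP B (or_introl erefl) _ _ Be0 Be.
by rewrite E ltnn in e0e.
Qed.

(** * Points of [Y] as module homomorphisms *)

Section Points.
Variables (n : nat) (P : lmodType k) (brP : P -> P -> P).
Variables (iota : L -> P) (x : 'I_n -> P).
Hypothesis hP : is_FrX brL brP iota x.
Variable Y : ptset n L.
Hypothesis hYalg : algebraic brL brP iota x Y.
Variables (M : lmodType R) (phi1 : P -> L) (phi2 : P -> M).
Hypothesis phiL : forall (s : k) f g, phi1 (s *: f + g) = s *: phi1 f + phi1 g
  /\ phi2 (s *: f + g) = (s%:MP : R) *: phi2 f + phi2 g.
Hypothesis phiB : forall f g, phi1 (brP f g) = brL (phi1 f) (phi1 g) /\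
  phi2 (brP f g) = al (phi1 g) *: phi2 f - al (phi1 f) *: phi2 g.
Hypothesis phiI : forall u, phi1 (iota u) = u /\ phi2 (iota u) = 0.
Hypothesis phiS : forall (u : L) (m : M), exists f, phi1 f = u /\ phi2 f = m.
Hypothesis phiR : forall f, (phi1 f = 0 /\ phi2 f = 0) <-> Rad brL brP iota x Y f.

Local Notation ev := (ev_hom brL brP iota x).

Lemma ev_exists (p : pt n L) : exists h, ev p h.
Proof.
case: hP => _ [_ [_ /(_ L brL brLie brMet id)]].
have idH : lie_hom brL brL id by [].
by move=> /(_ idH p) [h [h1 h2 h3 _]]; exists h.
Qed.

Lemma ev_unique (p : pt n L) h h' : ev p h -> ev p h' -> h =1 h'.
Proof.
case: hP => _ [_ [_ /(_ L brL brLie brMet id)]].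
have idH : lie_hom brL brL id by [].
move=> /(_ idH p) [h0 [_ _ _ U]] [a1 a2 a3] [b1 b2 b3] f.
by rewrite U // (U h').
Qed.

Lemma VsetE (S : P -> Prop) p h : ev p h -> Vset brL brP iota x S p <->
  forall f, S f -> h f = 0.
Proof.
move=> evh; split=> [V f Sf|V h' evh' f Sf]; first exact: V.
by rewrite (ev_unique evh' evh) V.
Qed.

(** A chosen preimage of $(0,m)$. It need not be linear in [m], but its defects from linearity lie
    in $\mathrm{Rad}(Y)$. *)
Definition lift0 (m : M) : P :=
  proj1_sig (constructive_indefinite_description _ (phiS 0 m)).

Lemma phi1_lift0 m : phi1 (lift0 m) = 0.
Proof. by rewrite /lift0; case: constructive_indefinite_description => ? []. Qed.

Lemma phi2_lift0 m : phi2 (lift0 m) = m.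
Proof. by rewrite /lift0; case: constructive_indefinite_description => ? []. Qed.

(** The pullback to $F_r[X]$ of the map $(u,m) \mapsto u + d(m)$ on $F_r \oplus M$. *)
Definition evd (d : M -> L) (f : P) : L := phi1 f + d (phi2 f).
Definition pt_of (d : M -> L) : pt n L := fun j => evd d (x j).

Lemma evd_lift0 d m : evd d (lift0 m) = d m.
Proof. by rewrite /evd phi1_lift0 phi2_lift0 add0r. Qed.

Lemma evd_hom d : mod_hom d -> ev (pt_of d) (evd d).
Proof.
move=> dH; split=> [|u|//]; last first.
  by rewrite /evd (phiI u).1 (phiI u).2 mod_hom0 // addr0.
split=> [s f g|f g]; rewrite /evd.
  by rewrite (phiL s f g).1 (phiL s f g).2 dH.1 scalerDr addrACA.
rewrite (phiB f g).1 (phiB f g).2.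
rewrite !(klinD (br_klinl brLie _)) !(klinD (br_klinr brLie _)) !dH.2.
rewrite (brC brLie (phi1 f) (d _)) dH.2 mod_hom_alpha // scale0r mod_hom0 // addr0.
by rewrite mod_homB // addrAC addrA.
Qed.

(** The equations of [Y] lie in $\mathrm{Rad}(Y)$, hence are killed by [phi1] and [phi2]. *)
Lemma Y_pt_of d : mod_hom d -> Y (pt_of d).
Proof.
move=> dH; case: hYalg => S YS; apply/YS/(VsetE _ (evd_hom dH)) => f Sf.
have /phiR [f1 f2] : Rad brL brP iota x Y f.
  by move=> p /YS V h evh; apply: V.
by rewrite /evd f1 f2 mod_hom0 // addr0.
Qed.

(** Evaluation at a point of [Y] kills $\mathrm{Rad}(Y)$ and so factors through $F_r \oplus M$; [d]
    is its restriction to [M]. *)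
Lemma Y_ev p : Y p -> exists d, mod_hom d /\ ev p (evd d).
Proof.
move=> Yp; have [h evh] := ev_exists p; have [[hL' hB] hI hx] := evh.
have hR f : phi1 f = 0 -> phi2 f = 0 -> h f = 0.
  by move=> f1 f2; have /phiR R0 : phi1 f = 0 /\ phi2 f = 0 by []; apply: R0 evh.
have hLin : klin h by move=> s u v; apply: hL'.
have p1L : klin phi1 by move=> s u v; case: (phiL s u v).
have p2B f g : phi2 (f - g) = phi2 f - phi2 g.
  have := (phiL 1 (f - g) g).2; rewrite !scale1r subrK => ->.
  by rewrite addrK.
have hE f g : phi1 f = phi1 g -> phi2 f = phi2 g -> h f = h g.
  move=> E1 E2; apply/eqP; rewrite -subr_eq0 -(klinB hLin); apply/eqP/hR.
    by rewrite (klinB p1L) E1 subrr.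
  by rewrite p2B E2 subrr.
pose d m := h (lift0 m).
have dH : mod_hom d.
  split=> [s m m'|m u]; rewrite /d.
    rewrite -hLin; apply: hE.
      by rewrite p1L !phi1_lift0 scaler0 addr0.
    by rewrite (phiL _ _ _).2 !phi2_lift0.
  rewrite -{1}(hI u) -hB; apply: hE.
    by rewrite (phiB _ _).1 !phi1_lift0 (klin0 (br_klinl brLie _)).
  rewrite (phiB _ _).2 !phi2_lift0 (phiI u).1 (phiI u).2 scaler0 subr0.
  by [].
exists d; split=> //; have [e1 e2 _] := evd_hom dH; split=> // j.
rewrite -hx /evd /d -[X in X + _]hI -(klinD hLin); apply: hE.
  by rewrite (klinD p1L) phi1_lift0 addr0 (phiI _).1.
have := (phiL 1 (iota (phi1 (x j))) (lift0 (phi2 (x j)))).2.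
by rewrite !scale1r (phiI _).2 phi2_lift0 add0r.
Qed.

(** Each step of the chain is separated by some [f] vanishing on the smaller set but not at a point
    of the larger one. A base point [q] in the last set turns these affine conditions into linear
    ones of triangular shape. *)
Lemma chain_le_rank m d : is_rank M d ->
  has_chain brL brP iota x Y m -> (m <= d)%N.
Proof.
move=> [_ rmax] [Z [Z0 Zai Zlt]].
have Zle i j : (i <= j)%N -> (j <= m)%N -> forall p, Z j p -> Z i p.
  elim: j => [|j IHj]; first by rewrite leqn0 => /eqP ->.
  rewrite leq_eqVlt ltnS => /orP [/eqP -> //|ij] jm p Zp.
  by apply: IHj => //; [exact: ltnW|exact: (Zlt j jm).1].
have ZY i : (i <= m)%N -> forall p, Z i p -> Y p.
  by move=> im p Zp; apply/Z0; apply: (Zle 0%N i).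
have [_ [[q Zq] _]] := Zai m (leqnn m).
have [dq [dqH evq]] := Y_ev (ZY m (leqnn m) q Zq).
have step (i : 'I_m) : exists df : (M -> L) * P, [/\ mod_hom df.1,
    evd df.1 df.2 <> 0,
    forall p h, Z i.+1 p -> ev p h -> h df.2 = 0 &
    exists2 p, Z i p & ev p (evd df.1)].
  have [_ [p [Zp NZp]]] := Zlt i (ltn_ord i).
  have [e [eH eve]] := Y_ev (ZY i (ltnW (ltn_ord i)) p Zp).
  have [[S ZS] _] := Zai i.+1 (ltn_ord i).
  have NV : ~ forall f, S f -> evd e f = 0.
    by move=> V; apply/NZp/ZS/(VsetE _ eve).
  have [f Nf] := not_all_ex_not _ _ NV.
  have [Sf Nf0] := imply_to_and _ _ Nf.
  exists (e, f); split=> //; last by exists p.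
  by move=> p' h /ZS V evh; apply: V.
pose df i := proj1_sig (constructive_indefinite_description _ (step i)).
have dfP i : [/\ mod_hom (df i).1, evd (df i).1 (df i).2 <> 0,
    forall p h, Z i.+1 p -> ev p h -> h (df i).2 = 0 &
    exists2 p, Z i p & ev p (evd (df i).1)].
  by rewrite /df; case: constructive_indefinite_description.
(* As [f] vanishes at [q], the difference of [d] and [dq] takes at [phi2 f] the value of [f] at the
   point of [d]. *)
have dqE i : dq (phi2 (df i).2) = - phi1 (df i).2.
  have [_ _ h _] := dfP i; apply/eqP; rewrite -addr_eq0 addrC; apply/eqP.
  exact: (h q (evd dq) (Zle _ _ (ltn_ord i) (leqnn m) _ Zq) evq).
apply: (rmax m (fun i => phi2 (df i).2)).
apply: (@triangular_lin_indep M m _ (fun i u => (df i).1 u - dq u)).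
- by move=> i; have [h _ _ _] := dfP i; apply: mod_hom_sub.
- by move=> i; rewrite dqE opprK addrC; have [_ h _ _] := dfP i.
move=> i j ji; rewrite dqE opprK addrC.
have [_ _ _ [p Zp evp]] := dfP i; have [_ _ h _] := dfP j.
exact: (h p _ (Zle _ _ ji (ltnW (ltn_ord i)) _ Zp) evp).
Qed.

(** * Irreducibility of annihilator sets *)

Section Annihilator.
Variable G : M -> Prop.

Definition ann : ptset n L :=
  fun p => Y p /\ forall h, ev p h -> forall m, G m -> h (lift0 m) = 0.

Lemma ann_algebraic : algebraic brL brP iota x ann.
Proof.
case: hYalg => S YS.
exists (fun f => S f \/ exists2 m, G m & f = lift0 m) => p; split.
  by case=> /YS V A h evh f [Sf|[m Gm ->]]; [apply: V | apply: A].
move=> V; split; first by apply/YS => h evh f Sf; apply: (V h) => //; left.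
by move=> h evh m Gm; apply: (V h) => //; right; exists m.
Qed.

Lemma annE p d : Y p -> ev p (evd d) -> ann p <-> forall m, G m -> d m = 0.
Proof.
move=> Yp evp; split=> [[_ A] m Gm|A]; first by rewrite -evd_lift0; apply: A.
split=> // h evh m Gm.
by rewrite (ev_unique evh evp) evd_lift0 A.
Qed.

Lemma ann_pt_of d : mod_hom d -> (forall m, G m -> d m = 0) -> ann (pt_of d).
Proof. by move=> dH dG; apply/(annE (Y_pt_of dH) (evd_hom dH)). Qed.

(* On the line [t |-> d + t (d' - d)] of points of [ann] every algebraic set
   which does not contain the line has at most one point, because [L'] is
   torsion-free; as [R] is infinite, finitely many of them do not cover it. *)
Lemma ann_avoid (As : list (ptset n L)) :
  (forall A, Lists.List.In A As ->
     algebraic brL brP iota x A /\ exists p, ann p /\ ~ A p) ->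
  exists d, [/\ mod_hom d, (forall m, G m -> d m = 0) &
    forall A, Lists.List.In A As -> ~ A (pt_of d)].
Proof.
elim: As => [|A As IH] AsP; first by exists (fun=> 0); split=> //; exact: mod_hom_zero.
have [|d [dH dG dAs]] := IH; first by move=> B inB; apply: AsP; right.
have [Ad|NAd] := classic (A (pt_of d)); last first.
  by exists d; split=> // B [<-|]; last exact: dAs.
have [_ [p [annp NAp]]] := AsP A (or_introl erefl).
have Yp := annp.1; have [d' [d'H evp]] := Y_ev Yp.
have d'G := (annE Yp evp).1 annp.
(* The line joins [d], outside every member of [As], to [d'], outside [A], so no set in the list
   contains it. *)
pose e m := d' m - d m; have eH : mod_hom e by exact: mod_hom_sub.
pose line (t : R) m := d m + e (t *: m).
have lineH t : mod_hom (line t) by exact: mod_hom_shift.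
have lineG t m : G m -> line t m = 0.
  by move=> Gm; rewrite /line mod_hom_scale0 ?dG ?addr0 // /e d'G // dG // subr0.
have two B t t' : algebraic brL brP iota x B ->
    B (pt_of (line t)) -> B (pt_of (line t')) -> t <> t' ->
    exists S : P -> Prop, (forall q, B q <-> Vset brL brP iota x S q) /\
      forall f, S f -> evd d f = 0 /\ e (phi2 f) = 0.
  case=> S BS /BS/(VsetE _ (evd_hom (lineH t))) Bt.
  move=> /BS/(VsetE _ (evd_hom (lineH t'))) Bt' tt'; exists S; split=> // f Sf.
  have e0 : e (phi2 f) = 0.
    have evl s : evd (line s) f = evd d f + e (s *: phi2 f) by exact: addrA.
    have : e ((t - t') *: phi2 f) = 0.
      rewrite scalerBl mod_homB //; apply/eqP; rewrite subr_eq0; apply/eqP.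
      by apply: (addrI (evd d f)); rewrite -!evl Bt // Bt'.
    case/(mod_hom_torsion_free eH) => // /eqP.
    by rewrite subr_eq0 => /eqP.
  split=> //; rewrite -[RHS](Bt f Sf) /evd /line.
  by rewrite (mod_hom_scale0 eH) // addr0.
have [N NP] : exists N, forall i, (N <= i)%N -> forall B,
    Lists.List.In B (Lists.List.map (fun B (t : R) => B (pt_of (line t))) (A :: As)) ->
    ~ B ('X_o0 ^+ i).
  (* Powers of a variable give infinitely many parameters even when [k] is finite. *)
  apply: (@cofinitely_many_avoid _ (fun i => ('X_o0 : R) ^+ i)) => [i j|B inB].
    rewrite !mpolyXn => /(congr1 (mcoeff (U_(o0) *+ i)%MM)).
    rewrite !mcoeffX eqxx; case: eqP => [E _|_ /eqP]; last by rewrite oner_eq0.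
    have := congr1 (fun m : 'X_{1..r} => m o0) E.
    by rewrite !mulmnE mnm1E eqxx !mul1n.
  have [B' [<- inB']] := proj1 (Lists.List.in_map_iff _ _ _) inB.
  move=> t t' Bt Bt'; apply: NNPP => tt'.
  have [S [BS B0]] := two B' t t' (AsP B' inB').1 Bt Bt' tt'.
  case: inB' => [AB|/dAs]; last first.
    by apply; apply/BS/(VsetE _ (evd_hom dH)) => f /B0 [].
  apply: NAp; rewrite AB; apply/BS/(VsetE _ evp) => f /B0 [df ef].
  by rewrite -df /evd -[d' _](subrK (d (phi2 f))) -/(e _) ef add0r.
exists (line ('X_o0 ^+ N)); split=> [|m|B inB].
- exact: lineH.
- exact: lineG.
apply: (NP N (leqnn N) (fun t => B (pt_of (line t)))).
exact: (Lists.List.in_map (fun B (t : R) => B (pt_of (line t))) _ _ inB).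
Qed.

(** A closed set not containing [ann] misses one of its points through a single finite union of
    algebraic sets. For two such closed sets, [ann_avoid] on the joined lists yields a point of
    [ann] outside both. *)
Lemma ann_irreducible : irreducible brL brP iota x ann.
Proof.
split.
  by exists (pt_of (fun=> 0)); apply: ann_pt_of => //; apply: mod_hom_zero.
move=> D1 D2 [F1 [F1a D1E]] [F2 [F2a D2E]] cov; apply: NNPP => N.
have [N1 N2] := not_or_and _ _ N.
have wit (D : ptset n L) F : (forall p, D p <-> forall s, F s ->
      exists A, Lists.List.In A s /\ A p) -> ~ (forall p, ann p -> D p) ->
    exists s p, [/\ F s, ann p & forall A, Lists.List.In A s -> ~ A p].
  move=> DE ND; have [p Np] := not_all_ex_not _ _ ND.
  have [annp NDp] := imply_to_and _ _ Np.
  have NF : ~ forall s, F s -> exists A, Lists.List.In A s /\ A p.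
    by move=> h; apply/NDp/DE.
  have [s Ns] := not_all_ex_not _ _ NF.
  have [Fs NA] := imply_to_and _ _ Ns.
  by exists s, p; split=> // A inA Ap; apply: NA; exists A.
have [s1 [p1 [F1s annp1 Np1]]] := wit _ _ D1E N1.
have [s2 [p2 [F2s annp2 Np2]]] := wit _ _ D2E N2.
have [|d [dH dG davoid]] := @ann_avoid (s1 ++ s2).
  move=> A inAs; have [inA|inA] := Lists.List.in_app_or _ _ _ inAs.
    by split; [exact: F1a inA|exists p1; split=> //; exact: Np1].
  by split; [exact: F2a inA|exists p2; split=> //; exact: Np2].
case: (cov _ (ann_pt_of dH dG)) => [/D1E/(_ _ F1s)|/D2E/(_ _ F2s)] [A [inA]].
  by apply: davoid; apply: Lists.List.in_or_app; left.
by apply: davoid; apply: Lists.List.in_or_app; right.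
Qed.

End Annihilator.

Lemma rank_chain d : fin_gen M -> is_rank M d -> has_chain brL brP iota x Y d.
Proof.
move=> Mfg Mrk; have [v [D [th [vI D0 thL thv]]]] := rank_coordinates Mfg Mrk.
(* [G 0] is empty, so the chain starts at [Y]. *)
pose G i m := exists2 j : 'I_d, (j < i)%N & m = v j.
exists (fun i => ann (G i)); split=> [p|i _|i id].
- by split=> [[]|Yp] //; split=> // h _ m [].
- by split; [exact: ann_algebraic|exact: ann_irreducible].
split=> [p [Yp A]|].
  split=> // h evh m [j ji ->]; apply: (A h evh).
  by exists j => //; exact: ltnW.
(* Composing [act] with the coordinate [th i'] kills $v_j$ for $j < i$ but sends $v_i$ to [act D],
   nonzero because [act] is injective. *)
pose i' := Ordinal id; have H := act_mod_hom (thL i').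
exists (pt_of (fun m => act (th i' m))); split.
  apply: ann_pt_of => // m [j ji ->]; rewrite thv (_ : i' == j = false).
    by rewrite mul0r (klin0 act_klin).
  by apply: contraTF ji => /eqP <-; rewrite ltnn.
move/(annE _ (Y_pt_of H) (evd_hom H))/(_ (v i')) => A.
have /act_eq0/eqP : act (th i' (v i')) = 0 by apply: A; exists i'.
by rewrite thv eqxx mul1r (negPf D0).
Qed.

End Points.

End FreeMetabelian.

Theorem theorem5p2 (k : finFieldType) (r : nat) (hr : (2 <= r)%N)
  (L : lmodType k) (brL : L -> L -> L) (a : 'I_r -> L)
  (hL : is_free_metab brL a)
  (c : L -> 'rV[k]_r) (hc : abel_coords brL a c)
  (n : nat) (P : lmodType k) (brP : P -> P -> P) (iota : L -> P) (x : 'I_n -> P)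
  (hP : is_FrX brL brP iota x)
  (Y : ptset n L)
  (hYalg : algebraic brL brP iota x Y)
  (hYirr : irreducible brL brP iota x Y)
  (M : lmodType {mpoly k[r]})
  (hMfg : fin_gen M) (hMtf : torsion_free M)
  (hiso : coord_iso brL c brP iota x Y M) :
  exists d : nat, is_rank M d /\ is_dim brL brP iota x Y d.
Proof.
have [d Mrk] := is_rank_exists hMfg; exists d; split=> //.
have [phi1 [phi2 [phiL phiB phiI phiS phiR]]] := hiso.
split; first exact: (rank_chain hL hc hr hP hYalg phiL phiB phiI phiS phiR hMfg Mrk).
by move=> m; apply: (chain_le_rank hL hc hr hP phiL phiB phiI phiS phiR Mrk).
Qed.
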